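(* Let $\mathcal M$ be a label of finite type with $(X(\mathcal M),S)$ and $(X_+(\mathcal M),S)$ the associated subshifts. (a) $X(\mathcal M)=\{S^k(x[\mathcal N]):k\in\mathbb Z,\ \mathcal N\in\Theta(\mathcal M)\}$ and $X_+(\mathcal M)=\{S^k(x_+[\mathcal N]):k\in\mathbb Z,\ \mathcal N\in\Theta(\mathcal M)\}$. (b) If $Y$ is a nonempty, closed, shift invariant subset of $X(\mathcal M)$ then $Y=X(\Phi(Y))=\{S^k(x[\mathcal N]):k\in\mathbb Z,\ \mathcal N\in\Phi(Y)\}$. (c) If $Y$ is a nonempty, closed, shift invariant subset of $X_+(\mathcal M)$ then $Y=X_+(\Phi_+(Y))=\{S^k(x_+[\mathcal N]):k\in\mathbb Z,\ \mathcal N\in\Phi_+(Y)\}$.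
   Context: Write $\mathbb N=\{1,2,\dots\}$. An $\mathbb N$-vector is a function $\mathbf m:\mathbb N\to\{0,1,2,\dots\}$ with finite support $\mathrm{supp}\,\mathbf m$; $FIN(\mathbb N)$ is the additive monoid of all $\mathbb N$-vectors, with identity $\mathbf 0$ and the pointwise order. A label is a set $\mathcal M\subset FIN(\mathbb N)$ such that $\mathbf 0\le\mathbf m_1\le\mathbf m\in\mathcal M$ implies $\mathbf m_1\in\mathcal M$; it is of finite type if it contains no infinite strictly increasing sequence. $\mathcal{LAB}$ is the space of all labels (including $\emptyset$) with the ultrametric $d(\mathcal M_1,\mathcal M_2)=\inf\{2^{-N}:N\ge0,\ \mathcal M_1\cap\mathcal B_N=\mathcal M_2\cap\mathcal B_N\}$, where $\mathcal B_N$ is the set of $\mathbb N$-vectors $\mathbf m$ with $\mathbf m_\ell<N$ for all $\ell$ and $\mathrm{supp}\,\mathbf m\subset[1,N]$. For $\mathbf r\in FIN(\mathbb N)$, $\mathcal M-\mathbf r=\{\mathbf w\in FIN(\mathbb N):\mathbf w+\mathbf r\in\mathcal M\}$; $\Theta(\mathcal M)$ is the closure in $\mathcal{LAB}$ of $\{\mathcal M-\mathbf r:\mathbf r\in FIN(\mathbb N)\}$. Fix an odd integer $b\ge5$ and a partition $\{D_\ell:\ell\in\mathbb N\}$ of $\mathbb N$ into infinite sets with $\min D_\ell<\min D_{\ell+1}$. Define $k:\mathbb Z\to\mathbb Z$ by $k(n)=b^{n-1}$ for $n\ge1$, $k(0)=0$, $k(-n)=-k(n)$. $IP(k)$ (resp.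 $IP_+(k)$) is the set of sums of finite subsets of $k(\mathbb Z)$ (resp. of $k(\{0,1,2,\dots\})$). Each $t\in IP(k)$ has a unique expansion $t=k(j_1)+\dots+k(j_r)$ with $|j_1|>\dots>|j_r|>0$ ($r=0$ for $t=0$); its length vector $\mathbf r(t)\in FIN(\mathbb N)$ is $\mathbf r(t)_\ell=\#\{i:|j_i|\in D_\ell\}$. For a label $\mathcal M$, $A[\mathcal M]=\{t\in IP(k):\mathbf r(t)\in\mathcal M\}$, $A_+[\mathcal M]=A[\mathcal M]\cap IP_+(k)$, and $x[\mathcal M],x_+[\mathcal M]\in\{0,1\}^{\mathbb Z}$ are the characteristic functions of $A[\mathcal M]$ and $A_+[\mathcal M]$. $S$ is the shift on $\{0,1\}^{\mathbb Z}$, $S(x)_t=x_{t+1}$. $X(\mathcal M)$, $X_+(\mathcal M)$ are the orbit closures (under $S^n$, $n\in\mathbb Z$) of $x[\mathcal M]$, $x_+[\mathcal M]$. For a nonempty $\Psi\subset\mathcal{LAB}$, $X(\Psi)$ (resp. $X_+(\Psi)$) is the smallest closed shift-invariant set containing $x[\mathcal N]$ (resp. $x_+[\mathcal N]$) for all $\mathcal N\in\Psi$. For $Y\subset\{0,1\}^{\mathbb Z}$, $\Phi(Y)=\{\mathcal N\in\mathcal{LAB}:x[\mathcal N]\in Y\}$ and $\Phi_+(Y)=\{\mathcal N\in\mathcal{LAB}:x_+[\mathcal N]\in Y\}$. (In the displayed sets $S^k$ denotes a power of the shift with $k\in\mathbb Z$.) *)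

(* Defs.v *)
From HB Require Import structures.
From mathcomp Require Import all_boot all_order all_algebra finmap.
From mathcomp Require Import all_classical all_reals all_analysis.

Set Implicit Arguments.
Unset Strict Implicit.
Unset Printing Implicit Defensive.

Import Order.TTheory GRing.Theory Num.Theory.

Local Open Scope classical_set_scope.
Local Open Scope ring_scope.

(* The coordinates of vectors and the blocks D_1, D_2, ... are indexed from 0:
   the index l : nat stands for l + 1.  The elements of the blocks keep their
   actual values in {1, 2, ...}. *)

Definition FIN : set (nat -> nat) :=
  [set m | finite_set [set l | m l != 0%N]].

Definition vec_le (m1 m2 : nat -> nat) : Prop := forall l, (m1 l <= m2 l)%N.

Record label := Label {
  label_set :> set (nat -> nat);
  label_FIN : label_set `<=` FIN;
  label_down : forall m1 m, vec_le m1 m -> label_set m -> label_set m1 }.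

Definition finite_type (M : label) : Prop :=
  ~ exists u : nat -> nat -> nat,
      forall n, [/\ label_set M (u n), vec_le (u n) (u n.+1) & u n <> u n.+1].

Lemma label_eq (M1 M2 : label) : label_set M1 = label_set M2 -> M1 = M2.
Proof.
case: M1 M2 => [A1 f1 d1] [A2 f2 d2] /= e; case: _ / e in f2 d2 *.
by rewrite (Prop_irrelevance f1 f2) (Prop_irrelevance d1 d2).
Qed.

Lemma FIN_le m1 m : vec_le m1 m -> FIN m -> FIN m1.
Proof.
move=> le_m; apply: sub_finite_set => l /=; rewrite -!lt0n => m1l.
exact: leq_trans (le_m l).
Qed.

Section label_sub.
Variables (M : label) (r : nat -> nat).

Let A : set (nat -> nat) := [set w | FIN w /\ label_set M (fun l => w l + r l)%N].

Let A_FIN : A `<=` FIN. Proof. by move=> w []. Qed.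

Let A_down m1 m : vec_le m1 m -> A m -> A m1.
Proof.
move=> le_m [Fm Mm]; split; first exact: FIN_le Fm.
by apply: label_down Mm => l; rewrite leq_add2r.
Qed.

Definition label_sub : label := Label A_FIN A_down.

End label_sub.

(* With 0-based coordinates, supp m c [1, N] becomes l < N on the support. *)
Definition box (N : nat) : set (nat -> nat) :=
  [set m | (forall l, (m l < N)%N) /\ (forall l, m l != 0%N -> (l < N)%N)].

Definition label_dist (R : realType) (M1 M2 : label) : R :=
  inf [set 2 ^- N | N in [set N : nat | M1 `&` box N = M2 `&` box N]].

Section label_metric.
Variable R : realType.
Implicit Types M : label.

Let agree M1 M2 : set nat := [set N | M1 `&` box N = M2 `&` box N].
Let dists M1 M2 : set R := [set 2 ^- N | N in agree M1 M2].

Lemma box_le N1 N2 : (N1 <= N2)%N -> box N1 `<=` box N2.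
Proof.
by move=> leN m [b s]; split=> [l|l /s ?]; exact: leq_trans leN.
Qed.

Lemma box0 : box 0 = set0.
Proof. by apply/seteqP; split=> // m [/(_ 0%N)]. Qed.

Lemma box_cover m : FIN m -> exists N, box N m.
Proof.
move=> /finite_fsetP[F eF].
exists (maxn (\max_(l <- F) m l) (\max_(l <- F) l)).+1.
have lF l : m l != 0%N -> l \in F.
  by move=> ml; have : [set l | m l != 0%N] l by []; rewrite eF.
split=> l; rewrite ltnS leq_max.
  have [->//|/lF lf] := eqVneq (m l) 0%N.
  by rewrite leq_bigmax_seq.
by move=> /lF lf; rewrite (@leq_bigmax_seq _ _ xpredT id) ?orbT.
Qed.

Let agree_le M1 M2 N1 N2 : (N1 <= N2)%N -> agree M1 M2 N2 -> agree M1 M2 N1.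
Proof.
rewrite /agree /= => leN e.
have -> : box N1 = box N2 `&` box N1 by rewrite setIC setIidl//; exact: box_le.
by rewrite (setIA (label_set M1)) e -setIA.
Qed.

Let dists_lb M1 M2 : lbound (dists M1 M2) 0.
Proof. by move=> _ [N _ <-]; rewrite invr_ge0 exprn_ge0. Qed.

Let dists_has_lb M1 M2 : has_lbound (dists M1 M2).
Proof. by exists 0; exact: dists_lb. Qed.

Let dists_neq0 M1 M2 : dists M1 M2 !=set0.
Proof. by exists (2 ^- 0); exists 0%N => //; rewrite /agree /= box0 !setI0. Qed.

Let dist_le M1 M2 N : agree M1 M2 N -> label_dist R M1 M2 <= 2 ^- N.
Proof. by move=> ag; apply: (ge_inf (dists_has_lb M1 M2)); exists N. Qed.

Lemma label_dist_ge0 M1 M2 : 0 <= label_dist R M1 M2.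
Proof. exact: (lb_le_inf (dists_neq0 M1 M2) (@dists_lb M1 M2)). Qed.

Lemma label_distxx M : label_dist R M M = 0.
Proof.
apply/eqP; rewrite eq_le label_dist_ge0 andbT.
apply/ler_addgt0Pl => e e0; rewrite addr0.
have [N Ne] := ltr_add_invr (e0 : 0 < e).
apply: le_trans (@dist_le M M N erefl) _.
apply/ltW/(le_lt_trans _ Ne); rewrite add0r lef_pV2 ?posrE ?exprn_gt0//.
by rewrite -natrX ler_nat ltn_expl.
Qed.

Lemma label_dist_pos M1 M2 : label_dist R M1 M2 = 0 -> M1 = M2.
Proof.
move=> d0; apply: label_eq.
have ag N : agree M1 M2 N.
  apply: contrapT => nag.
  have : 2 ^- N <= label_dist R M1 M2.
    apply: lb_le_inf; first exact: dists_neq0.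
    move=> _ [N' ag <-].
    rewrite lef_pV2 ?posrE ?exprn_gt0//.
    have [NN'|/ltnW NN'] := leqP N N'; first by case: nag; exact: agree_le ag.
    by rewrite ler_eXn2l ?ltr1n.
  by rewrite d0 leNgt invr_gt0 exprn_gt0.
apply/seteqP; split=> m Mm.
  have [N bN] := box_cover (label_FIN Mm).
  by have : (label_set M1 `&` box N) m by []; rewrite (ag N) => -[].
have [N bN] := box_cover (label_FIN Mm).
by have : (label_set M2 `&` box N) m by []; rewrite -(ag N) => -[].
Qed.

Lemma label_dist_sym M1 M2 : label_dist R M1 M2 = label_dist R M2 M1.
Proof.
rewrite /label_dist; congr (inf _).
by apply/seteqP; split=> _ [N /= e <-]; exists N.
Qed.

Lemma label_dist_ultra M2 M1 M3 :
  label_dist R M1 M3 <= Num.max (label_dist R M1 M2) (label_dist R M2 M3).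
Proof.
rewrite leNgt; apply/negP; rewrite gt_max => /andP[].
move=> /(inf_lt (dists_neq0 _ _))[_ [N1 a1 <-] l1].
move=> /(inf_lt (dists_neq0 _ _))[_ [N2 a2 <-] l2].
have [N12|/ltnW N21] := leqP N1 N2.
  have /dist_le : agree M1 M3 N1.
    by rewrite /agree /= a1; exact: agree_le a2.
  by rewrite leNgt l1.
have /dist_le : agree M1 M3 N2.
  by rewrite /agree /= -a2; exact: agree_le a1.
by rewrite leNgt l2.
Qed.

Lemma label_dist_triangle M2 M1 M3 :
  label_dist R M1 M3 <= label_dist R M1 M2 + label_dist R M2 M3.
Proof.
apply: le_trans (label_dist_ultra M2 M1 M3) _.
by rewrite ge_max lerDl lerDr !label_dist_ge0.
Qed.

End label_metric.

(* [LAB R] is the type [label], carrying the metric [label_dist R]. *)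
Definition LAB (R : realType) : Type := label.

HB.instance Definition _ (R : realType) := gen_eqMixin (LAB R).
HB.instance Definition _ (R : realType) := gen_choiceMixin (LAB R).
HB.instance Definition _ (R : realType) := isMetric.Build R (LAB R)
  (@label_distxx R) (@label_dist_pos R) (@label_dist_sym R)
  (@label_dist_triangle R).

Definition Theta (R : realType) (M : label) : set label :=
  closure ([set label_sub M r | r in FIN] : set (LAB R)).

(* [Negz n] is the integer -(n + 1). *)
Definition kfun (b : nat) (n : int) : int :=
  match n with
  | Posz 0 => 0
  | Posz n'.+1 => (b ^ n')%N%:Z
  | Negz n' => - (b ^ n')%N%:Z
  end.

Definition finite_sums (A : set int) : set int :=
  [set \sum_(x <- F) x | F in [set F : {fset int} | [set` F] `<=` A]].

Definition IP (b : nat) : set int := finite_sums (range (kfun b)).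

Definition IPplus (b : nat) : set int :=
  finite_sums (kfun b @` [set n : int | 0 <= n]).

Definition is_expansion (b : nat) (t : int) (s : seq int) : Prop :=
  [/\ sorted (fun i j => `|j|%N < `|i|%N)%N s,
      all (fun j => j != 0) s
    & t = \sum_(j <- s) kfun b j].

(* The expansion exists and is unique for t in IP b, b >= 3; the default
   value [::] is only taken for t outside IP b. *)
Definition expansion (b : nat) (t : int) : seq int :=
  xget [::] [set s | is_expansion b t s].

Definition length_vec (b : nat) (D : nat -> set nat) (t : int) : nat -> nat :=
  fun l => count (fun j => `|j|%N \in D l) (expansion b t).

Definition Aset (b : nat) (D : nat -> set nat) (M : label) : set int :=
  [set t | IP b t /\ label_set M (length_vec b D t)].

Definition Aset_plus (b : nat) (D : nat -> set nat) (M : label) : set int :=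
  Aset b D M `&` IPplus b.

Definition bin_seq : topologicalType := prod_topology (fun _ : int => bool).

Definition xpt (b : nat) (D : nat -> set nat) (M : label) : bin_seq :=
  fun t : int => t \in Aset b D M.

Definition xpt_plus (b : nat) (D : nat -> set nat) (M : label) : bin_seq :=
  fun t : int => t \in Aset_plus b D M.

Definition shift (x : bin_seq) : bin_seq := fun t : int => x (t + 1).

Definition shift_inv (x : bin_seq) : bin_seq := fun t : int => x (t - 1).

Definition shift_pow (k : int) : bin_seq -> bin_seq :=
  match k with
  | Posz n => iter n shift
  | Negz n => iter n.+1 shift_inv
  end.

Lemma shiftK : cancel shift shift_inv.
Proof. by move=> x; apply/funext => t; rewrite /shift /shift_inv subrK. Qed.

Lemma shift_invK : cancel shift_inv shift.
Proof. by move=> x; apply/funext => t; rewrite /shift /shift_inv addrK. Qed.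

Definition shift_invariant (Y : set bin_seq) : Prop := shift @` Y = Y.

Definition orbit_closure (x : bin_seq) : set bin_seq :=
  closure (range (fun k : int => shift_pow k x)).

Definition Xlab (b : nat) (D : nat -> set nat) (M : label) : set bin_seq :=
  orbit_closure (xpt b D M).

Definition Xlab_plus (b : nat) (D : nat -> set nat) (M : label) :
    set bin_seq :=
  orbit_closure (xpt_plus b D M).

Definition generated_subshift (E : set bin_seq) : set bin_seq :=
  smallest [set Y | closed Y /\ shift_invariant Y] E.

Definition Xfam (b : nat) (D : nat -> set nat) (Psi : set label) :
    set bin_seq :=
  generated_subshift (xpt b D @` Psi).

Definition Xfam_plus (b : nat) (D : nat -> set nat) (Psi : set label) :
    set bin_seq :=
  generated_subshift (xpt_plus b D @` Psi).

Definition Phi (b : nat) (D : nat -> set nat) (Y : set bin_seq) : set label :=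
  [set N | Y (xpt b D N)].

Definition Phi_plus (b : nat) (D : nat -> set nat) (Y : set bin_seq) :
    set label :=
  [set N | Y (xpt_plus b D N)].

(* For nonempty A; the default value 0 is never used. *)
Definition set_min (A : set nat) : nat :=
  xget 0%N [set n | A n /\ forall p, A p -> (n <= p)%N].

(* Main.v *)
Require Import Defs.
From mathcomp Require Import all_boot all_order all_algebra finmap.
From mathcomp Require Import all_classical all_reals all_analysis.
From mathcomp Require Import zify.

(** Since [b >= 3], the expansion of an element of [IP b] behaves like a
    positional system: a sum of terms of index at most [L] has absolute value
    less than [b ^ L / 2], while a sum of terms of index greater than [L] is a
    multiple of [b ^ L].  Hence, if [h] is a list of indices greater than [L]
    and [t] is small compared with [b ^ L], then every expansion of
    [expval b h + t] is [h] followed by an expansion of [t]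
    ([expansion_split]).  In a window around the origin, the translate of
    [A[M]] by the value of [h] is thus [A[M - r]], with [r] the length vector
    of [h] ([digit_set_sub]).

    The inclusion of the points [S^k x[N]], for [N] in [Theta M], into [X(M)]
    follows: [N] is approximated by labels [M - r], and, as every [D l] is
    infinite, each [r] is the length vector of some [h] with indices as large
    as desired ([Theta_orbit]).

    Conversely, let [y] be a nonzero point of [X(M)], say [y t0 = 1].  Take an
    ultrafilter [U] on the exponents [k] along which [S^k x[M]] tends to [y].
    For [U]-almost every [k], [t0 + k] has an expansion with length vector in
    [M].  Each index belongs either to almost all or to almost none of these
    expansions.  If infinitely many indices were of the first kind,
    truncating the expansions would give an infinite strictly increasing
    sequence in [M]; as [M] has finite type, almost all expansions are [h k ++ s] with one
    and the same tail [s], and with the indices in [h k] tending to infinity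
    ([common_tail]).  If [N] is the [U]-limit of the labels
    [M - lengths D (h k)], which exists and lies in [Theta M] by
    [Theta_ultra], then [y] is a translate of [x[N]] ([orbit_Theta]).  The zero
    point is [x[N]] for the empty label [N], which is [M - r] for any [r]
    outside [M].

    The points [x_+[M]] are handled at the same time, by a predicate [P] on
    the indices allowed in the expansions.  The statements about a subsystem
    [Y] are formal consequences: [S^k x[N]] is in [Y] if and only if [x[N]]
    is ([subshift_of_points]). *)

Import Order.TTheory GRing.Theory Num.Theory.
Local Open Scope classical_set_scope.
Local Open Scope ring_scope.

(** * Expansions *)

Definition abs_gt : rel int := fun i j => (`|j| < `|i|)%N.

Lemma abs_gt_trans : transitive abs_gt.
Proof. by move=> j i k ij jk; apply: ltn_trans jk ij. Qed.

Lemma abs_gt_irr : irreflexive abs_gt.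
Proof. by move=> i; rewrite /abs_gt ltnn. Qed.

Definition expval (b : nat) (s : seq int) : int := \sum_(j <- s) kfun b j.

Definition lengths (D : nat -> set nat) (s : seq int) : nat -> nat :=
  fun l => count (fun j => `|j|%N \in D l) s.

Lemma expval_cat b s1 s2 : expval b (s1 ++ s2) = expval b s1 + expval b s2.
Proof. exact: big_cat. Qed.

Lemma lengths_cat D s1 s2 :
  lengths D (s1 ++ s2) = (fun l => lengths D s1 l + lengths D s2 l)%N.
Proof. by apply/funext => l; exact: count_cat. Qed.

Lemma abs_kfun b j : j != 0 -> `|kfun b j|%N = (b ^ `|j|.-1)%N.
Proof. by case: j => [[|n]|n] //= _; rewrite abszN. Qed.

Lemma kfun_ge0 b j : (0 < b)%N -> (0 <= kfun b j) = (0 <= j).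
Proof.
by move=> b0; case: j => [[|n]|n] //=; rewrite oppr_ge0 leNgt ltz_nat expn_gt0 b0.
Qed.

Lemma kfunN b j : kfun b (- j) = - kfun b j.
Proof. by case: j => [[|n]|n] //=; rewrite ?oppr0 ?opprK. Qed.

(** With top index [i], the absolute value is at most [3/2] of that of the
    leading term, and [3/2 * b ^ (|i| - 1) <= b ^ L / 2] because [b >= 3]. *)
Lemma expval_bound b L s : (3 <= b)%N ->
  sorted abs_gt s -> all (fun j => j != 0) s ->
  all (fun j => `|j| <= L)%N s -> (2 * `|expval b s| < b ^ L)%N.
Proof.
move=> b3; elim: s L => [|i s IH] L.
  by move=> _ _ _; rewrite /expval big_nil expn_gt0; lia.
rewrite /= (path_sortedE abs_gt_trans) => /andP[si ss] /andP[i0 s0] /andP[iL _].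
have i_gt0 : (0 < `|i|)%N by rewrite absz_gt0.
have /(IH _ ss s0) : all (fun j => `|j| <= `|i|.-1)%N s.
  by apply: sub_all si => j; rewrite /abs_gt; lia.
rewrite /expval big_cons -/(expval b s) -(abs_kfun b i i0) => bs.
have : (b * `|kfun b i| <= b ^ L)%N.
  by rewrite abs_kfun// -expnS prednK// leq_pexp2l//; lia.
have : (3 * `|kfun b i| <= b * `|kfun b i|)%N by rewrite leq_mul2r b3 orbT.
lia.
Qed.

Lemma expval_cons b j s : expval b (j :: s) = kfun b j + expval b s.
Proof. exact: big_cons. Qed.

Lemma expansion_behead b t j s : is_expansion b t (j :: s) ->
  [/\ j != 0, is_expansion b (t - kfun b j) s
    & (3 <= b)%N -> (2 * `|expval b s| < `|kfun b j|)%N].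
Proof.
case=> /=; rewrite (path_sortedE abs_gt_trans) => /andP[js ss] /andP[j0 s0] ->.
split=> //.
  by split=> //; rewrite big_cons addrC addKr.
move=> b3; rewrite abs_kfun//; apply: expval_bound => //.
by apply: sub_all js => i; rewrite /abs_gt; lia.
Qed.

(** The leading term exceeds twice the rest, so it determines the sign of the
    sum and, up to a factor smaller than [b], its size; leading terms of equal
    sums therefore agree, and one can remove them. *)
Lemma expansion_uniq b t s1 s2 : (3 <= b)%N ->
  is_expansion b t s1 -> is_expansion b t s2 -> s1 = s2.
Proof.
move=> b3; have b0 : (0 < b)%N by lia.
elim: s1 s2 t => [|i s1 IH] [|j s2] t //.
- move=> [_ _ ->] e2; have [j0 _ /(_ b3)] := expansion_behead _ _ _ _ e2.
  case: e2 => _ _; rewrite big_nil -/(expval b (_ :: _)) expval_cons; lia.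
- move=> e1 [_ _ t0]; have [j0 _ /(_ b3)] := expansion_behead _ _ _ _ e1.
  case: e1 => _ _; rewrite t0 big_nil -/(expval b (_ :: _)) expval_cons; lia.
- move=> e1 e2; have [i0 e1' b1] := expansion_behead _ _ _ _ e1.
  have [j0 e2' b2] := expansion_behead _ _ _ _ e2.
  suff ij : i = j by rewrite ij in e1' *; congr (_ :: _); exact: IH e1' e2'.
  have {b1}b1 := b1 b3; have {b2}b2 := b2 b3.
  have : kfun b i + expval b s1 = kfun b j + expval b s2.
    by rewrite -!expval_cons /expval; case: e1 => _ _ <-; case: e2.
  wlog ij : i j s1 s2 e1 e2 e1' e2' i0 j0 b1 b2 {IH} / (`|i| <= `|j|)%N.
    move=> H; have /orP[ij|ji] := leq_total `|i| `|j|; first exact: H.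
    by move=> e; apply/esym; exact: (H j i s2 s1).
  move=> e; have [eij|nij] := eqVneq `|i|%N `|j|%N.
    have [//|ij'] : i = j \/ i = - j by lia.
    by move: e b1; rewrite ij' kfunN abszN; lia.
  have := abs_kfun b i i0; have := abs_kfun b j j0.
  have : (b ^ `|i|.-1 * 3 <= b ^ `|j|.-1)%N.
    have -> : `|j|.-1%N = (`|i|.-1 + (`|j| - `|i|).-1.+1)%N by lia.
    rewrite expnD leq_mul2l expnS; apply/orP; right.
    by rewrite (leq_trans b3)// leq_pmulr// expn_gt0 b0.
  lia.
Qed.

Lemma dvd_expval b L s : all (fun j => (L < `|j|))%N s ->
  exists q : int, expval b s = q * (b ^ L)%N%:Z.
Proof.
elim: s => [|j s IH] /=; first by exists 0; rewrite /expval big_nil mul0r.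
move=> /andP[Lj /IH[q qs]]; rewrite expval_cons qs.
suff [p ->] : exists p : int, kfun b j = p * (b ^ L)%N%:Z.
  by exists (p + q); rewrite mulrDl.
case: j Lj => [[|n]|n] //= Ln; [exists (b ^ (n - L))%N|exists (- (b ^ (n - L))%N%:Z)];
by rewrite ?mulNr -PoszM -expnD subnK.
Qed.

Lemma sorted_split_abs n s : sorted abs_gt s ->
  s = [seq j <- s | (n < `|j|)%N] ++ [seq j <- s | (`|j| <= n)%N].
Proof.
elim: s => [//|j s IH] /=; rewrite (path_sortedE abs_gt_trans) => /andP[js ss].
have [jn|nj] /= := leqP `|j| n; last by rewrite -IH.
have sn i : i \in s -> (`|i| <= n)%N.
  by move=> /(allP js); rewrite /abs_gt; lia.
rewrite (eq_in_filter (a2 := pred0)) => [|i /sn]; last by rewrite ltnNge => ->.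
by rewrite filter_pred0 (eq_in_filter (a2 := predT)) ?filter_predT.
Qed.

Lemma sorted_cat_abs n s1 s2 :
  sorted abs_gt s1 -> sorted abs_gt s2 ->
  all (fun j => n < `|j|)%N s1 -> all (fun j => `|j| <= n)%N s2 ->
  sorted abs_gt (s1 ++ s2).
Proof.
rewrite !(sorted_pairwise abs_gt_trans) pairwise_cat => -> -> h1 h2.
rewrite !andbT; apply/allrelP => i j /(allP h1) ni /(allP h2) jn.
exact: leq_ltn_trans jn ni.
Qed.

(** The converse of [expval_bound]: a leading term of index greater than [L]
    cannot be compensated by the other terms. *)
Lemma expansion_bound b t s L : (3 <= b)%N ->
  is_expansion b t s -> (2 * `|t| < b ^ L)%N ->
  all (fun j => `|j| <= L)%N s.
Proof.
case: s => [//|j s] b3 es tL; have [j0 _ /(_ b3) js] := expansion_behead _ _ _ _ es.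
have [so s0 te] := es; rewrite -/(expval _ _) expval_cons in te.
suff jL : (`|j| <= L)%N.
  move: so; rewrite /= (path_sortedE abs_gt_trans) jL => /andP[+ _].
  by apply: sub_all => i /ltnW/leq_trans; apply.
rewrite leqNgt; apply/negP => Lj.
have : (b ^ L <= b ^ `|j|.-1)%N by rewrite leq_pexp2l//; lia.
rewrite -abs_kfun//; lia.
Qed.

(** Split [s'] into its indices greater than [L], and the others, forming [s].
    Then [t - expval b s] is a multiple of [b ^ L], and it is smaller than
    [b ^ L] in absolute value, so it vanishes. *)
Lemma expansion_split b h t s' L : (3 <= b)%N ->
  all (fun j => L < `|j|)%N h -> sorted abs_gt h ->
  (2 * `|t| < b ^ L)%N ->
  is_expansion b (expval b h + t) s' ->
  exists2 s, s' = h ++ s & is_expansion b t s.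
Proof.
move=> b3 hL sh tL es'; have [so s0 te] := es'.
have e' := sorted_split_abs L _ so.
set h' := [seq j <- _ | _] in e'; set s := [seq j <- _ | _] in e'.
have so_s : sorted abs_gt s by exact: sorted_filter abs_gt_trans _ _ so.
have s_0 : all (fun j => j != 0) s.
  by apply/allP => j; rewrite mem_filter => /andP[_ /(allP s0)].
have ts : t = expval b s.
  move: te; rewrite e' -/(expval _ _) expval_cat.
  (* Both high parts are multiples of [b ^ L]; comparing the quotients. *)
  have [q ->] := dvd_expval b _ _ hL.
  have /(dvd_expval b)[q' ->] : all (fun j => L < `|j|)%N h' by exact: filter_all.
  have sL := expval_bound b L s b3 so_s s_0 (filter_all _ _).
  move=> e; suff qq : q = q' by move: e; rewrite qq => /addrI.
  apply/eqP; rewrite -subr_eq0 -absz_eq0; apply: contraTT isT => q0.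
  have : (b ^ L <= absz ((q - q') * (b ^ L)%N%:Z)%R)%N.
    by rewrite abszM leq_pmull// lt0n.
  have -> : (q - q') * (b ^ L)%N%:Z = expval b s - t.
    by rewrite mulrBl; move: e; lia.
  lia.
have est : is_expansion b t s by split.
exists s => //; apply: expansion_uniq b3 es' _; split.
- by apply: sorted_cat_abs sh so_s hL _; exact: filter_all.
- rewrite all_cat s_0 andbT; apply: sub_all hL => j.
  by rewrite -absz_gt0; lia.
- by rewrite -/(expval _ _) expval_cat ts.
Qed.

Lemma expansion_cat b h t s L : (3 <= b)%N ->
  all (fun j => L < `|j|)%N h -> sorted abs_gt h ->
  (2 * `|t| < b ^ L)%N ->
  is_expansion b t s -> is_expansion b (expval b h + t) (h ++ s).
Proof.
move=> b3 hL sh tL es; have [so s0 te] := es; split.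
- apply: sorted_cat_abs sh so hL _; exact: expansion_bound es tL.
- rewrite all_cat s0 andbT; apply: sub_all hL => j.
  by rewrite -absz_gt0; lia.
- by rewrite -/(expval _ _) expval_cat te.
Qed.

(** * Sums of finite subsets as expansions *)

Lemma kfun_inj b : (2 <= b)%N -> injective (kfun b).
Proof.
move=> b2 i j e; have b0 : (0 < b)%N by lia.
have bn n : (0 < b ^ n)%N by rewrite expn_gt0 b0.
have [i0|i0] := eqVneq i 0; first rewrite i0 in e *.
  by case: j e => [[|n]|n] //=; have := bn n; lia.
have [j0|j0] := eqVneq j 0.
  by rewrite j0 in e *; case: i e i0 => [[|n]|n] //=; have := bn n; lia.
have : `|kfun b i|%N = `|kfun b j|%N by rewrite e.
rewrite !abs_kfun// => /eqP; rewrite eqn_exp2l// => /eqP eij.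
have := kfun_ge0 b i b0; have := kfun_ge0 b j b0; rewrite e => ->; lia.
Qed.

(** The finite set is recorded inside the set of admissible terms used by [s],
    so that the same lemma serves [IP b] and [IPplus b]. *)
Lemma expansion_IP b t s : (2 <= b)%N -> is_expansion b t s ->
  (finite_sums [set kfun b j | j in [set` s]]) t.
Proof.
move=> b2 [so _ ->]; exists [fset x in map (kfun b) s]%fset.
  by move=> x /=; rewrite inE => /mapP[j js ->]; exists j.
rewrite -(big_map (kfun b) predT id); apply: perm_big; apply: uniq_perm.
- exact: fset_uniq.
- rewrite map_inj_uniq; first exact: sorted_uniq abs_gt_trans abs_gt_irr _ so.
  exact: kfun_inj.
- by move=> x; rewrite inE.
Qed.

Lemma sum_fsetD1 (c : int) (F : {fset int}) :
  \sum_(x <- F) x = (if c \in F then c else 0) + \sum_(x <- (F `\ c)%fset) x.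
Proof.
case: ifPn => [cF|cF]; first exact: big_fsetD1.
by rewrite add0r mem_fsetD1.
Qed.

(** The only relations to remove are the pairs of opposite terms, which cancel;
    so the sum keeps an expansion by terms of [F].  The terms are treated in
    increasing order of their absolute values. *)
Lemma finite_sums_expansion b (F : {fset int}) : (2 <= b)%N ->
  [set` F] `<=` range (kfun b) ->
  exists2 s, is_expansion b (\sum_(x <- F) x) s
    & all (fun j => kfun b j \in F) s.
Proof.
move=> b2 Fk.
(* For [j != 0], [|j|] is at most [b ^ (|j| - 1)], the absolute value of the
   term, so the terms bound the indices. *)
pose L := \max_(x <- F) `|x|%N.
have : forall x, x \in F -> exists2 j, x = kfun b j & (`|j| <= L)%N.
  move=> x xF; have [j _ jx] := Fk x xF; exists j => //.
  have : (`|x| <= L)%N by rewrite /L (@leq_bigmax_seq _ _ predT (fun x : int => `|x|%N)).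
  apply: leq_trans.
  have [->//|j0] := eqVneq j 0; rewrite -jx abs_kfun//.
  by have := ltn_expl `|j|.-1 b2; lia.
suff H : forall (L : nat) (F : {fset int}),
    (forall x, x \in F -> exists2 j, x = kfun b j & (`|j| <= L)%N) ->
    exists2 s, is_expansion b (\sum_(x <- F) x) s
      & all (fun j => (kfun b j \in F) && (`|j| <= L)%N) s.
  by move=> /H[s es sF]; exists s => //; apply: sub_all sF => j /andP[].
move=> {Fk}{}L {}F; elim: L F => [|L IH] F FL.
  exists [::] => //; split => //; rewrite big_nil big_seq big1// => x /FL[j ->].
  by rewrite leqn0 absz_eq0 => /eqP ->.
(* Only the terms [c] and [- c] have index of absolute value [L.+1]. *)
pose c := kfun b L.+1; pose F' := (F `\ c `\ - c)%fset.
have /IH[s [so s0 es] sF] :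
    forall x, x \in F' -> exists2 j, x = kfun b j & (`|j| <= L)%N.
  move=> x; rewrite !inE => /and3P[xc1 xc2 /FL[j xj jL]]; exists j => //.
  rewrite leqNgt; apply/negP => Lj.
  have [ej|ej] : j = L.+1 \/ j = - L.+1%:Z by lia.
    by rewrite xj ej eqxx in xc2.
  by rewrite xj ej kfunN eqxx in xc1.
have sF' : all (fun j => (kfun b j \in F) && (`|j| <= L.+1)%N) s.
  by apply: sub_all sF => j /andP[]; rewrite !inE => /and3P[_ _ ->] /=; lia.
have c0 : - c != c.
  have : (0 < b ^ L)%N by rewrite expn_gt0; lia.
  by rewrite /c/=; lia.
have -> : \sum_(x <- F) x = (if c \in F then c else 0)
    + (if - c \in F then - c else 0) + expval b s.
  by rewrite (sum_fsetD1 c) (sum_fsetD1 (- c)) !inE c0 /= es addrA.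
have top i : `|i|%N = L.+1 -> kfun b i \in F ->
    exists2 s1, is_expansion b (kfun b i + expval b s) s1
      & all (fun j => (kfun b j \in F) && (`|j| <= L.+1)%N) s1.
  move=> iL iF; exists (i :: s); last by rewrite /= iF iL leqnn.
  split; last by rewrite -/(expval b (i :: s)) expval_cons.
    rewrite /= (path_sortedE abs_gt_trans) so andbT; apply: sub_all sF => j.
    by rewrite /abs_gt iL ltnS => /andP[].
  by rewrite /= s0 andbT -absz_eq0 iL.
have e0 : is_expansion b (expval b s) s by [].
have kN : - c = kfun b (- L.+1%:Z) by rewrite kfunN.
case: ifPn => cF; case: ifPn => ncF.
- by rewrite subrr add0r; exists s.
- by rewrite addr0; apply: top.
- by rewrite add0r kN; apply: top; rewrite ?abszN -?kN.
- by rewrite !add0r; exists s.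
Qed.

(** For [P] true everywhere this is [A[M]]; for [P] the nonnegative indices it
    is [A_+[M]]. *)
Definition digit_set b D (P : pred int) (M : label) : set int :=
  [set t | exists s, [/\ is_expansion b t s, all P s & label_set M (lengths D s)]].

Lemma expansionE b t s : (3 <= b)%N -> is_expansion b t s -> expansion b t = s.
Proof.
move=> b3 es; apply: (expansion_uniq _ _ _ _ b3 _ es).
exact: (@xgetPex _ [::] [set s | is_expansion b t s] (ex_intro _ s es)).
Qed.

Lemma finite_sums_sub A B : A `<=` B -> finite_sums A `<=` finite_sums B.
Proof. by move=> AB _ [F FA <-]; exists F => // x /FA /AB. Qed.

Lemma AsetE b D M : (3 <= b)%N -> Aset b D M = digit_set b D predT M.
Proof.
move=> b3; have b2 : (2 <= b)%N by lia.
apply/seteqP; split => t.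
  move=> [[F Fk <-] Mt]; have [s es _] := finite_sums_expansion b F b2 Fk.
  by exists s; split; rewrite ?all_predT// -(expansionE _ _ _ b3 es).
move=> [s [es _ Ms]]; split; last by rewrite /length_vec (expansionE _ _ _ b3 es).
apply: finite_sums_sub (expansion_IP _ _ _ b2 es).
by move=> _ [j _ <-]; exists j.
Qed.

(** An element of [IPplus b] in [A[M]] has an expansion with terms from a set of
    nonnegative terms; by uniqueness this is the expansion that defines its
    length vector. *)
Lemma Aset_plusE b D M : (3 <= b)%N ->
  Aset_plus b D M = digit_set b D (fun j => 0 <= j) M.
Proof.
move=> b3; have b2 : (2 <= b)%N by lia.
rewrite /Aset_plus AsetE//; apply/seteqP; split => t.
  move=> [[s [es _ Ms]] [F Fk Ft]].
  exists s; split=> //.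
  have [|s' es' s'F] := finite_sums_expansion b F b2.
    by move=> x /Fk[j _ <-]; exists j.
  rewrite Ft in es'; rewrite (expansion_uniq _ _ _ _ b3 es es').
  apply: sub_all s'F => j /(Fk _)[i /= i0] /(kfun_inj _ b2) <- //.
move=> [s [es Ps Ms]]; split; first by exists s; split; rewrite ?all_predT.
apply: finite_sums_sub (expansion_IP _ _ _ b2 es).
by move=> _ [j /(allP Ps) js <-]; exists j.
Qed.

(** * Topology of binary sequences and of labels *)

Lemma shift_powE k (x : bin_seq) t : shift_pow k x t = x (t + k).
Proof.
case: k => n /=.
  by elim: n t => [|n IH] t; rewrite ?addr0//= {1}/Defs.shift IH; congr x; lia.
have H m s : iter m shift_inv x s = x (s - m%:Z).
  by elim: m s => [|m IH] s; rewrite ?subr0//= {1}/shift_inv IH; congr x; lia.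
by rewrite {1}/shift_inv H; congr x; lia.
Qed.

Lemma nbhs_coord (y : bin_seq) t : nbhs y [set z : bin_seq | z t = y t].
Proof.
have := @proj_continuous int (fun=> bool) t y [set v | v = y t].
by apply; exact: discrete_set1.
Qed.

Lemma cvg_coord T (F : set_system T) (f : T -> bin_seq) (y : bin_seq) :
  Filter F -> (forall t, F [set a | f a t = y t]) -> f @ F --> y.
Proof.
move=> FF Fy; apply/cvg_sup => t U [V] [[W] oW <-] WfN WU.
apply: (filterS WU); rewrite /nbhs/=; apply: filterS (Fy t) => a /= fa.
by have : W (f a t) by rewrite fa; exact: WfN.
Qed.

Lemma closure_coord T (F : set_system T) (E : set bin_seq) (f : T -> bin_seq)
    (y : bin_seq) : ProperFilter F -> (forall a, E (f a)) ->
  (forall t, F [set a | f a t = y t]) -> closure E y.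
Proof.
move=> FF Ef /cvg_coord fy.
apply: (closed_cvg _ (@closed_closure _ E)) fy.
by apply: nearW => a; exact: subset_closure.
Qed.

(** The traces of the neighbourhoods of [y] on the index set generate a proper
    filter; any ultrafilter refining it works. *)
Lemma closure_ultra T (f : T -> bin_seq) (y : bin_seq) :
  closure (range f) y ->
  exists U : set_system T, UltraFilter U /\ forall t, U [set a | f a t = y t].
Proof.
move=> cly; pose F := filter_from (nbhs y) (fun B => f @^-1` B).
have FF : ProperFilter F.
  apply: filter_from_proper; last by move=> B /cly[_ [[a _ <-] Ba]]; exists a.
  apply: filter_from_filter; first by exists setT; exact: filterT.
  by move=> A B nA nB; exists (A `&` B); first exact: filterI.
have [U [UU FU]] := ultraFilterLemma FF.
exists U; split=> // t; apply: FU.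
by exists [set z | z t = y t]; first exact: nbhs_coord.
Qed.

Lemma finite_box N : finite_set (box N).
Proof.
pose g (f : {ffun 'I_N -> 'I_N}) (l : nat) : nat :=
  if insub l is Some i then f i else 0%N.
apply: (@sub_finite_set _ _ (range g)); last exact: finite_image finite_finset.
move=> m [mN ml]; exists [ffun i : 'I_N => Ordinal (mN i)] => //.
apply/funext => l; rewrite /g; case: insubP => [i _ <-|]; first by rewrite ffunE.
by move=> lN; apply/esym/eqP; apply: contraNT lN => /ml.
Qed.

Lemma ThetaP (R : realType) (M N : label) :
  Theta R M N <->
  forall n, exists2 r, FIN r & label_sub M r `&` box n = N `&` box n.
Proof.
split=> [cN n|H].
  have e0 : (0 : R) < 2 ^- n by rewrite invr_gt0 exprn_gt0.
  have [_ [[r Fr <-]]] := cN _ (nbhsx_ballx (N : LAB R) _ e0).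
  rewrite /ball/= => dr; exists r => //.
  have : (label_dist R N (label_sub M r) < 2 ^- n) by [].
  move=> /inf_lt[].
    by exists (2 ^- 0), 0%N => //=; rewrite box0 !setI0.
  move=> _ [m /= em <-]; rewrite ltf_pV2 ?posrE ?exprn_gt0// ltr_eXn2l ?ltr1n//.
  move=> nm.
  have -> : box n = box m `&` box n
    by rewrite setIC setIidl//; apply: box_le; exact: ltnW.
  by rewrite (setIA (label_set N)) (setIA (label_set (label_sub M r))) em.
move=> B /nbhs_ballP[e /= e0 eB].
have [n ne] := ltr_add_invr e0; rewrite add0r in ne.
have [r Fr rN] := H n; exists (label_sub M r); split; first by exists r.
apply: eB; rewrite /ball/=.
suff : label_dist R N (label_sub M r) < e by [].
apply: le_lt_trans ne; apply: (@le_trans _ _ (2 ^- n)).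
  apply: ge_inf; first by exists 0 => _ [m _ <-]; rewrite invr_ge0 exprn_ge0.
  by exists n.
by rewrite lef_pV2 ?posrE ?exprn_gt0// -natrX ler_nat ltn_expl.
Qed.

(** * Length vectors *)

(** Each index in [s] is counted in at most one block. *)
Lemma FIN_lengths D s : trivIset setT D -> FIN (lengths D s).
Proof.
move=> tD; elim: s => [|j s IH]; first by apply: (@sub_finite_set _ _ set0).
apply: (@sub_finite_set _ _
  ([set l | D l `|j|%N] `|` [set l | lengths D s l != 0%N])).
  move=> l /=; rewrite /lengths /= -/(lengths D s l).
  by case: (boolP (_ \in _)) => [/set_mem|_]; [left|rewrite add0n; right].
rewrite finite_setU; split=> //.
have [[l0 Dl0]|nD] := pselect (exists l, D l `|j|%N).
  apply: (@sub_finite_set _ _ [set l0]) => // l /= Dl.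
  by apply: tD => //; exists `|j|%N.
apply: (@sub_finite_set _ _ set0) => // l Dl; apply: nD; by exists l.
Qed.

Lemma infinite_unbounded (A : set nat) n : infinite_set A ->
  exists2 j, A j & (n < j)%N.
Proof.
move=> Ainf; apply: contrapT => nA; apply: Ainf.
apply: sub_finite_set (finite_II n.+1) => j Aj /=.
by rewrite ltnS leqNgt; apply/negP => nj; apply: nA; exists j.
Qed.

(** The vector [r] is built up by adding unit vectors; each is realized by an
    index larger than all the preceding ones, which becomes the new head of the
    list. *)
Lemma lengths_realize D r n : trivIset setT D ->
  (forall l, infinite_set (D l)) -> FIN r ->
  exists h, [/\ sorted abs_gt h, all (fun j => n < `|j|)%N h,
    all (fun j => 0 < j) h & lengths D h = r].
Proof.
move=> tD iD /box_cover[N [_ rN]].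
have {rN} : forall l, (N <= l)%N -> r l = 0%N.
  by move=> l Nl; apply/eqP; apply: contraTT Nl; rewrite -ltnNge; exact: rN.
elim: N r => [|N IHN] r rN.
  by exists [::]; split=> //; apply/funext => l; rewrite rN.
(* [c] counts the indices still to be placed in the last block [D N]. *)
move cE : (r N) => c; elim: c r rN cE => [|c IHc] r rN rNc.
  by apply: IHN => l; rewrite leq_eqVlt => /predU1P[<-//|]; exact: rN.
pose r' l := if l == N then c else r l.
have [h [hs hn h0 hr]] : exists h, [/\ sorted abs_gt h,
    all (fun j => n < `|j|)%N h, all (fun j => 0 < j) h & lengths D h = r'].
  apply: IHc; last by rewrite /r' eqxx.
  by move=> l Nl; rewrite /r' gtn_eqF// rN.
have [j Dj hj] :=
  infinite_unbounded _ (maxn n (\max_(i <- h) `|i|%N)) (iD N).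
exists (j%:Z :: h); split.
- rewrite /= (path_sortedE abs_gt_trans) hs andbT; apply/allP => i ih.
  apply: leq_ltn_trans hj; rewrite leq_max; apply/orP; right.
  exact: (@leq_bigmax_seq _ _ predT (fun i : int => `|i|%N)).
- by rewrite /= hn andbT (leq_ltn_trans _ hj)// leq_maxl.
- by rewrite /= h0 andbT; lia.
- apply/funext => l; rewrite /lengths /= -/(lengths D h l) hr /r'.
  have [->|lN] := eqVneq l N; first by rewrite mem_set// rNc.
  rewrite memNset// => Dl; move/eqP: lN; apply.
  by apply: tD => //; exists j.
Qed.

Lemma lengths_filter_le D p s : vec_le (lengths D [seq j <- s | p j]) (lengths D s).
Proof. by move=> l; rewrite leq_count_subseq// filter_subseq. Qed.

(** Every nonzero index lies in some block, so dropping one is visible in the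
    length vector; this makes proper truncations give strictly smaller
    vectors. *)
Lemma lengths_filter_eq D p s : cover setT D = [set n | (0 < n)%N] ->
  all (fun j => j != 0) s -> lengths D [seq j <- s | p j] = lengths D s -> all p s.
Proof.
move=> cD s0 e; apply/allP => j js; apply: contraT => pj.
have [l _ Dl] : cover setT D `|j|%N by rewrite cD /= absz_gt0; exact: (allP s0).
have : lengths D [seq j <- s | p j] l = lengths D s l by rewrite e.
rewrite /lengths; set a := (fun j => _).
rewrite -[RHS]size_filter -(count_predC p) count_filter [in RHS]count_filter.
rewrite (@eq_count _ (predI p a) (predI a p)) => [|i]; last by rewrite /= andbC.
rewrite -{1}[X in X = _]addn0 => /addnI/esym/eqP.
rewrite -leqn0 leqNgt -has_count => /hasPn/(_ j).
rewrite mem_filter js andbT => /(_ _)/negP.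
by rewrite /a mem_set//= => /(_ isT)/(_ pj).
Qed.

(** * Limits of translates *)

Definition digit_pt b D P (M : label) : bin_seq := fun t => t \in digit_set b D P M.

(** Translating by a number with only large indices acts,
    near the origin, as subtracting its length vector from the label. *)
Lemma digit_set_sub b D P (M : label) h L t : (3 <= b)%N -> trivIset setT D ->
  sorted abs_gt h -> all (fun j => L < `|j|)%N h -> all P h ->
  (2 * `|t| < b ^ L)%N ->
  digit_set b D P M (expval b h + t) <->
  digit_set b D P (label_sub M (lengths D h)) t.
Proof.
move=> b3 tD hs hL hP tL; split=> [[s' [es' Ps' Ms']]|[s [es Ps [_ Ms]]]].
  have [s e es] := expansion_split _ _ _ _ _ b3 hL hs tL es'.
  exists s; split=> //; first by move: Ps'; rewrite e all_cat => /andP[].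
  split; first exact: FIN_lengths.
  move: Ms'; rewrite e lengths_cat; congr (label_set M _).
  by apply/funext => l; rewrite addnC.
exists (h ++ s); split; first exact: expansion_cat hL hs tL es.
  by rewrite all_cat hP.
rewrite lengths_cat; move: Ms; congr (label_set M _).
by apply/funext => l; rewrite addnC.
Qed.

(** Close to [N] there is [M - r]; realizing [r] by indices greater than [n]
    gives a translate of the point of [M] that agrees with the point of [N] at a
    given coordinate as soon as [n] is large. *)
Lemma Theta_orbit (R : realType) b D (P : pred int) (M N : label) k : (3 <= b)%N ->
  trivIset setT D -> (forall l, infinite_set (D l)) ->
  (forall j, 0 < j -> P j) -> Theta R M N ->
  orbit_closure (digit_pt b D P M) (shift_pow k (digit_pt b D P N)).
Proof.
move=> b3 tD iD P0 /ThetaP NM.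
have /choice[h hP] n : exists h, [/\ sorted abs_gt h,
    all (fun j => n < `|j|)%N h, all P h
    & label_sub M (lengths D h) `&` box n = N `&` box n].
  have [r Fr rN] := NM n.
  have [h [hs hn h0 hr]] := lengths_realize D r n tD iD Fr.
  exists h; split=> //; last by rewrite hr.
  by apply: sub_all h0 => j /P0.
apply: (@closure_coord _ \oo _
  (fun n => shift_pow (k + expval b (h n)) (digit_pt b D P M))).
  by move=> n; exists (k + expval b (h n)).
move=> t; pose u : int := t + k.
have tn n : (2 * `|u| <= n)%N -> (2 * `|u| < b ^ n)%N.
  by move=> tn; rewrite (leq_ltn_trans tn)// ltn_expl//; lia.
have eqn n : (2 * `|u| <= n)%N ->
  (forall s, is_expansion b u s -> box n (lengths D s)) ->
  digit_set b D P M (expval b (h n) + u) <-> digit_set b D P N u.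
  move=> /tn {}tn bn; have [hs hn Ph hN] := hP n.
  rewrite (digit_set_sub _ _ _ _ _ _ _ b3 tD hs hn Ph tn).
  split=> -[s [es Ps Ms]]; exists s; split=> //.
    have : (label_sub M (lengths D (h n)) `&` box n) (lengths D s).
      by split=> //; exact: bn.
    by rewrite hN => -[].
  have : (N `&` box n) (lengths D s) by split=> //; exact: bn.
  by rewrite -hN => -[].
have [m bm] : exists m, forall s, is_expansion b u s -> box m (lengths D s).
  have [[s es]|ns] := pselect (exists s, is_expansion b u s); last first.
    by exists 0%N => s es; case: ns; exists s.
  have [m bm] := box_cover (FIN_lengths D s tD).
  by exists m => s' es'; rewrite (expansion_uniq _ _ _ _ b3 es' es).
exists (maxn m (2 * `|u|)%N) => // n /=; rewrite geq_max => /andP[mn nt].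
rewrite !shift_powE addrA [t + k + _]addrC.
apply: asbool_equiv_eq; apply: eqn => // s /bm.
exact: box_le.
Qed.

Lemma filter_forall_finite T I (U : set_system T) (B : set I) (Q : T -> I -> Prop) :
  Filter U -> finite_set B -> (forall i, B i -> U [set a | Q a i]) ->
  U [set a | forall i, B i -> Q a i].
Proof.
move=> FU Bfin BQ; have {}Bfin : finite_set (B : set {classic I}) by [].
move/finite_fsetP: Bfin => [X BX].
have : U (\bigcap_(i in [set` X]) [set a | Q a i]).
  by apply: filter_bigI => i iX; apply: BQ; rewrite BX.
by apply: filterS => a /= aQ i Bi; apply: aQ; rewrite -BX.
Qed.

(** Along an ultrafilter, finitely many properties simultaneously take their
    limit truth values. *)
Lemma ultra_decide T I (U : set_system T) (B : set I) (Q : T -> I -> Prop) :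
  UltraFilter U -> finite_set B ->
  U [set a | forall i, B i -> (Q a i <-> U [set a' | Q a' i])].
Proof.
move=> UU Bfin; apply: filter_forall_finite => // i Bi.
have [Ui|Ui] := in_ultra_setVsetC [set a | Q a i] UU.
  by apply: filterS (Ui) => a /= Qa; split.
apply: filterS (Ui) => a /= nQ; split => // Ui'.
by have [c [/= nQc /nQc]] := filter_ex (filterI Ui Ui').
Qed.

(** Compactness of the space of labels, in the form needed: the labels
    [M - r a] converge along [U], since membership of each vector is decided by
    [U] and each box is finite. *)
Lemma Theta_ultra (R : realType) T (U : set_system T) (M : label)
    (r : T -> nat -> nat) : UltraFilter U -> (forall a, FIN (r a)) ->
  exists2 N, Theta R M N &
    forall w, label_set N w <-> U [set a | label_set (label_sub M (r a)) w].
Proof.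
move=> UU Fr.
pose A : set (nat -> nat) := [set w | U [set a | label_set (label_sub M (r a)) w]].
have AF : A `<=` FIN.
  by move=> w /filter_ex[a]; exact: label_FIN.
have Ad m1 m : vec_le m1 m -> A m -> A m1.
  by move=> le_m; apply: filterS => a; exact: label_down.
exists (Label AF Ad) => //; apply/ThetaP => n.
have /filter_ex[a aP] := ultra_decide _ _ _ _
  (fun a w => label_set (label_sub M (r a)) w) UU (finite_box n).
exists (r a) => //; apply/seteqP; split=> w [Mw bw]; split=> //.
  exact/(aP w bw).
exact/(aP w bw).
Qed.

(** Otherwise one could pick a subsequence without repetitions. *)
Lemma finite_type_stationary (M : label) (u : nat -> nat -> nat) : finite_type M ->
  (forall n, label_set M (u n)) -> (forall n m, (n <= m)%N -> vec_le (u n) (u m)) ->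
  exists n, forall m, (n <= m)%N -> u m = u n.
Proof.
move=> Mft Mu le_u; apply: contrapT => H; apply: Mft.
have /choice[g gP] n : exists m, (n <= m)%N /\ u n <> u m.
  apply: contrapT => nH; apply: H; exists n => m nm; apply/esym; apply: contrapT => unm.
  by apply: nH; exists m.
exists (fun n => u (iter n g 0%N)) => n; split=> //=; last by case: (gP (iter n g 0%N)).
by apply: le_u; case: (gP (iter n g 0%N)).
Qed.

(** Let [d] be the set of indices that lie in almost all [e a].  The
    truncation [s n] of [d] to the indices at most [n] is a truncation of some
    [e a], hence has its length vector in [M].  These vectors increase with [n],
    so by finite type they stabilize, and then the [s n] stabilize too. *)
Lemma common_tail T (U : set_system T) D (M : label) (e : T -> seq int) :
  UltraFilter U -> finite_type M -> cover setT D = [set n | (0 < n)%N] ->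
  U [set a | [/\ sorted abs_gt (e a), all (fun j => j != 0) (e a)
               & label_set M (lengths D (e a))]] ->
  exists s, forall n,
    U [set a | exists2 h, e a = h ++ s & all (fun j => n < `|j|)%N h].
Proof.
move=> UU Mft cD Ue.
pose d : set int := [set j | U [set a | j \in e a]].
pose low n (l : seq int) := [seq j <- l | (`|j| <= n)%N].
pose G n : set T := [set a | [/\ sorted abs_gt (e a), all (fun j => j != 0) (e a),
    label_set M (lengths D (e a)) &
    forall j : int, (`|j| <= n)%N -> (j \in e a <-> d j)]].
have Ud n : U (G n).
  have fin : finite_set [set j : int | (`|j| <= n)%N].
    apply: (@sub_finite_set _ _ [set` [seq i%:Z - n%:Z | i <- iota 0 (n + n).+1]]).
      move=> j jn; apply/mapP; rewrite /= in jn; exists (absz (j + n%:Z)%R); last by lia.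
      by rewrite mem_iota; lia.
    exact: finite_seq.
  have dec := ultra_decide _ _ _ _ (fun a j => j \in e a) UU fin.
  by apply: filterS (filterI Ue dec) => a [[ss s0 Ms] dd].
have /choice[c cP] n : exists a, G n a by exact: filter_ex (Ud n).
pose s n := low n (e (c n)).
have ss n : sorted abs_gt (s n).
  by have [so _ _ _] := cP n; exact: (sorted_filter abs_gt_trans).
have sE n j : j \in s n <-> d j /\ (`|j| <= n)%N.
  have [_ _ _ dP] := cP n; rewrite mem_filter.
  by split=> [/andP[jn /(dP _ jn)]|[dj jn]]//; rewrite jn; exact/dP.
have s_low n m : (n <= m)%N -> s n = low n (s m).
  move=> nm; apply: (irr_sorted_eq abs_gt_trans abs_gt_irr) => //.
    exact: (sorted_filter abs_gt_trans).
  move=> j; apply/idP/idP => [/sE[dj jn]|].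
    by rewrite mem_filter jn; apply/sE; split=> //; exact: leq_trans nm.
  rewrite [_ \in low n (s m)]mem_filter => /andP[jn /sE[dj _]].
  by apply/sE.
have [n0 n0P] : exists n, forall m, (n <= m)%N ->
    lengths D (s m) = lengths D (s n).
  apply: (finite_type_stationary M (fun n => lengths D (s n))) => // n.
    have [_ _ Ms _] := cP n; apply: label_down Ms; exact: lengths_filter_le.
  by move=> m /s_low ->; exact: lengths_filter_le.
have s_n0 m : (n0 <= m)%N -> s m = s n0.
  move=> nm; rewrite (s_low _ _ nm); apply/esym/all_filterP.
  apply: (lengths_filter_eq _ _ _ cD); last by rewrite -/(low n0 (s m)) -s_low// n0P.
  have [_ s0 _ _] := cP m; apply/allP => j.
  by rewrite mem_filter => /andP[_ /(allP s0)].
exists (s n0) => n; pose m := maxn n n0.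
apply: filterS (Ud m) => a [so _ _ dP].
exists [seq j <- e a | (m < `|j|)%N]; last first.
  apply/allP => j; rewrite mem_filter => /andP[+ _].
  by apply: leq_ltn_trans; rewrite leq_maxl.
rewrite [LHS](sorted_split_abs m)//; congr (_ ++ _).
rewrite -(s_n0 m) ?leq_maxr//.
apply: (irr_sorted_eq abs_gt_trans abs_gt_irr) => //.
  exact: (sorted_filter abs_gt_trans).
move=> j; apply/idP/idP => [|/sE[dj jm]].
  by rewrite mem_filter => /andP[jm /(dP _ jm) dj]; apply/sE.
by rewrite mem_filter jm; exact/dP.
Qed.

(** The multiples of the first unit vector form a strictly increasing
    sequence. *)
Lemma finite_type_empty (M : label) : finite_type M ->
  exists2 r, FIN r & ~ label_set M r.
Proof.
move=> Mft; pose u n : nat -> nat := fun l => if l == 0%N then n else 0%N.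
apply: contrapT => H; apply: Mft; exists u => n; split.
- apply: contrapT => nM; apply: H; exists (u n) => //.
  apply: (@sub_finite_set _ _ [set 0%N]) => // l /=.
  by rewrite /u; case: (l =P 0%N) => [->|_]; rewrite ?eqxx.
- by move=> l; rewrite /u; case: ifP.
- by move=> /(congr1 (fun f => f 0%N)); rewrite /u /=; lia.
Qed.

Lemma orbit_Theta (R : realType) b D (P : pred int) (M : label) (y : bin_seq) :
  (3 <= b)%N ->
  trivIset setT D -> cover setT D = [set n | (0 < n)%N] -> finite_type M ->
  orbit_closure (digit_pt b D P M) y ->
  exists k, exists2 N, Theta R M N & y = shift_pow k (digit_pt b D P N).
Proof.
move=> b3 tD cD Mft /closure_ultra[U [UU Uy]].
have {}Uy t : y t <-> U [set k : int | digit_set b D P M (t + k)].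
  split=> [yt|Ut].
    by apply: filterS (Uy t) => k /=; rewrite shift_powE yt => /set_mem.
  have [k /= [<-]] := filter_ex (filterI (Uy t) Ut).
  by rewrite shift_powE => Mk; apply/mem_set.
have [[t0 yt0]|y0] := pselect (exists t, y t); last first.
  have [r Fr nMr] := finite_type_empty M Mft.
  exists 0, (label_sub M r); first by apply: subset_closure; exists r.
  apply/funext => t; rewrite shift_powE.
  transitivity false; first by apply/negP => yt; apply: y0; exists t.
  apply/esym/negP => /set_mem[s [_ _ [_ Ms]]]; apply: nMr.
  by apply: label_down Ms => l; rewrite leq_addl.
have U0 := (Uy t0).1 yt0.
pose e (k : int) := expansion b (t0 + k).
have Ue : U [set k | [/\ is_expansion b (t0 + k) (e k), all P (e k)
    & label_set M (lengths D (e k))]].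
  apply: filterS U0 => k [s [es Ps Ms]].
  by rewrite /= /e (expansionE _ _ _ b3 es).
have [|s sP] := common_tail _ U D M e UU Mft cD.
  by apply: filterS Ue => k [[so s0 _] _ Ms].
(* [h k] is the part of [e k] before the tail [s]. *)
pose h k := take (size (e k) - size s) (e k).
have Uh n : U [set k | [/\ t0 + k = expval b (h k) + expval b s,
    sorted abs_gt (h k), all P (h k) & all (fun j => n < `|j|)%N (h k)]].
  apply: filterS (filterI Ue (sP n)) => k [[[so _ tk] Pe _] [h' eh h'n]] /=.
  have -> : h k = h' by rewrite /h eh size_cat addnK take_size_cat.
  split=> //.
  - by rewrite tk eh -/(expval _ _) expval_cat.
  - by move: so; rewrite eh => /cat_sorted2[].
  - by move: Pe; rewrite eh all_cat => /andP[].
have [N NT NP] := Theta_ultra R _ U M (fun k => lengths D (h k)) UU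
  (fun k => FIN_lengths D (h k) tD).
(* Almost surely [t0 + k = expval b (h k) + expval b s], so
   [t + k = expval b (h k) + (t + (expval b s - t0))]. *)
exists (expval b s - t0), N => //; apply/funext => t; rewrite shift_powE.
pose u : int := t + (expval b s - t0).
have Uu : U [set k | digit_set b D P M (t + k) <->
    digit_set b D P (label_sub M (lengths D (h k))) u].
  have ub : (2 * `|u| < b ^ (2 * `|u|))%N by rewrite ltn_expl//; lia.
  apply: filterS (Uh (2 * `|u|)%N) => k [tk hs Ph hn] /=.
  have -> : t + k = expval b (h k) + u by move: tk; rewrite /u; lia.
  exact: digit_set_sub b3 tD hs hn Ph ub.
apply/idP/idP => [/Uy Ut|/set_mem[s' [es' Ps' /NP Ns']]].
  apply/mem_set.
  have [k0 [/= H0 /H0[s' [es' Ps' _]]]] := filter_ex (filterI Uu Ut).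
  exists s'; split=> //; apply/NP.
  apply: filterS (filterI Uu Ut) => k [/= H /H[s2 [es2 _]]].
  by rewrite (expansion_uniq _ _ _ _ b3 es2 es').
apply/Uy; apply: filterS (filterI Uu Ns') => k [/= H Ms'].
by apply/H; exists s'.
Qed.

Lemma orbit_closure_digit_pt (R : realType) b D (P : pred int) (M : label) :
  (3 <= b)%N -> partition [set: nat] D [set n | (0 < n)%N] ->
  (forall l, infinite_set (D l)) -> (forall j, 0 < j -> P j) ->
  finite_type M ->
  orbit_closure (digit_pt b D P M) =
  [set shift_pow k (digit_pt b D P N) | k in [set: int] & N in Theta R M].
Proof.
move=> b3 [cD tD _] iD P0 Mft; apply/seteqP; split=> [y|_ [k _ [N NT <-]]].
  move=> /(orbit_Theta R _ _ _ _ _ b3 tD cD Mft)[k [N NT ->]].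
  by exists k => //; exists N.
exact: Theta_orbit NT.
Qed.

Lemma shift_pow_invariant (Y : set bin_seq) k x :
  shift_invariant Y -> Y x -> Y (shift_pow k x).
Proof.
move=> YS.
have S1 z : Y z -> Y (Defs.shift z) by move=> Yz; rewrite -YS; exists z.
have S2 z : Y z -> Y (Defs.shift_inv z).
  by rewrite -{1}YS => -[z' Yz' <-]; rewrite shiftK.
case: k => n Yx /=; first by elim: n => //= n; exact: S1.
by apply: (S2); elim: n => //= n; exact: S2.
Qed.

(** Each point of [Y] is some [S^k (pt N)]; the point [pt N] is then a translate
    of a point of [Y], hence in [Y]. *)
Lemma subshift_of_points (pt : label -> bin_seq) (Psi : set label)
    (Y : set bin_seq) : closed Y -> shift_invariant Y ->
  Y `<=` [set shift_pow k (pt N) | k in [set: int] & N in Psi] ->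
  let Phi := [set N | Y (pt N)] in
  Y = generated_subshift (pt @` Phi) /\
  generated_subshift (pt @` Phi) =
    [set shift_pow k (pt N) | k in [set: int] & N in Phi].
Proof.
move=> Yc YS Ypt Phi.
have YE : Y = [set shift_pow k (pt N) | k in [set: int] & N in Phi].
  apply/seteqP; split=> [y Yy|_ [k _ [N YN <-]]]; last exact: shift_pow_invariant.
  have [k _ [N _ yE]] := Ypt y Yy; exists k => //; exists N => //.
  rewrite /Phi/=; have -> : pt N = shift_pow (- k) y.
    by rewrite -yE; apply/funext => t; rewrite !shift_powE subrK.
  exact: shift_pow_invariant.
have gE : Y = generated_subshift (pt @` Phi).
  apply/seteqP; split.
    move=> y; rewrite YE => -[k _ [N YN <-]] Z [[_ ZS] ptZ].
    by apply: shift_pow_invariant => //; apply: ptZ; exists N.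
  by apply: smallest_sub => // _ [N YN <-].
by split; rewrite -gE.
Qed.

Theorem theorem3p34 (R : realType) (b : nat) (D : nat -> set nat)
  (b_odd : odd b) (b_ge5 : (5 <= b)%N)
  (D_part : partition [set: nat] D [set n | (0 < n)%N])
  (D_inf : forall l : nat, infinite_set (D l))
  (D_min : forall l : nat, (set_min (D l) < set_min (D l.+1))%N)
  (M : label) (M_ft : finite_type M) :
  [/\ (Xlab b D M = [set shift_pow k (xpt b D N)
                       | k in [set: int] & N in Theta R M]
       /\ Xlab_plus b D M = [set shift_pow k (xpt_plus b D N)
                               | k in [set: int] & N in Theta R M]),
      (forall Y : set bin_seq,
         Y !=set0 -> closed Y -> shift_invariant Y -> Y `<=` Xlab b D M ->
         Y = Xfam b D (Phi b D Y)
         /\ Xfam b D (Phi b D Y) = [set shift_pow k (xpt b D N)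
                                      | k in [set: int] & N in Phi b D Y])
    & (forall Y : set bin_seq,
         Y !=set0 -> closed Y -> shift_invariant Y ->
         Y `<=` Xlab_plus b D M ->
         Y = Xfam_plus b D (Phi_plus b D Y)
         /\ Xfam_plus b D (Phi_plus b D Y)
              = [set shift_pow k (xpt_plus b D N)
                   | k in [set: int] & N in Phi_plus b D Y])].
Proof.
have b3 : (3 <= b)%N by apply: leq_trans b_ge5.
have xE : xpt b D = digit_pt b D predT.
  by apply/funext => N; rewrite /xpt AsetE.
have xpE : xpt_plus b D = digit_pt b D (fun j => 0 <= j).
  by apply/funext => N; rewrite /xpt_plus Aset_plusE.
have XE : Xlab b D M = [set shift_pow k (xpt b D N)
                          | k in [set: int] & N in Theta R M].
  by rewrite /Xlab xE; exact: orbit_closure_digit_pt.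
have XpE : Xlab_plus b D M = [set shift_pow k (xpt_plus b D N)
                                | k in [set: int] & N in Theta R M].
  by rewrite /Xlab_plus xpE; apply: orbit_closure_digit_pt => // j /ltW.
split=> // Y _ Yc YS YX.
  by apply: (subshift_of_points _ (Theta R M)) => //; rewrite -XE.
by apply: (subshift_of_points _ (Theta R M)) => //; rewrite -XpE.
Qed.
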